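(* Let $T>0$, let $L$ and $g$ be the Lagrangian and terminal condition defined in the context, and let $V:[0,T]\times\mathbb{R}\to\mathbb{R}$ be given by $$V(t,x)=\begin{cases}\exp\!\big(-2\sqrt{x-t}\,\big)-1 & \text{if } x\ge t,\\ 1-\exp\!\big(-2\sqrt{t-x}\,\big) & \text{if } 2t-T\le x<t,\\ 1 & \text{if } x<2t-T.\end{cases}$$ Then $V$ is the value function corresponding to $L$ and $g$: for every $(t_0,x_0)\in[0,T]\times\mathbb{R}$, $$V(t_0,x_0)=\inf\Big\{\,g(x(T))+\int_{t_0}^{T}L(t,x(t),\dot x(t))\,dt\ :\ x(\cdot)\in\mathcal{A}([t_0,T],\mathbb{R}),\ x(t_0)=x_0\Big\}.$$
   Context: $\mathcal{A}([t_0,T],\mathbb{R})$ is the space of absolutely continuous functions from $[t_0,T]$ to $\mathbb{R}$. Define $\varphi:[0,T]\times\mathbb{R}\to\mathbb{R}$ by $\varphi(t,x)=\sqrt{|t-x|}\,\exp\!\big(2\sqrt{|t-x|}\big)$. The Lagrangian $L:[0,T]\times\mathbb{R}\times\mathbb{R}\to[0,+\infty]$ is $$L(t,x,v)=\begin{cases}+\infty & \text{if } |v|>2,\ t\neq x,\\ \frac{|v|}{2\varphi(t,x)} & \text{if } |v|\le 2,\ t\ne x,\\ 0 & \text{if } v=0,\ t=x,\\ +\infty & \text{if } v\neq 0,\ t=x.\end{cases}$$ The integral of the nonnegative function $t\mapsto L(t,x(t),\dot x(t))$ is understood in $[0,+\infty]$. The terminal condition $g:\mathbb{R}\to\mathbb{R}$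 is $g(x)=\exp(-2\sqrt{x-T})-1$ if $x\ge T$ and $g(x)=1$ if $x<T$. *)

(* Defs.v *)
From HB Require Import structures.
From mathcomp Require Import all_boot all_order all_algebra.
From mathcomp Require Import all_classical all_reals all_analysis.

Set Implicit Arguments.
Unset Strict Implicit.
Unset Printing Implicit Defensive.

Import Order.TTheory GRing.Theory Num.Theory.
Import numFieldNormedType.Exports.

Local Open Scope classical_set_scope.
Local Open Scope ring_scope.

(* The epsilon-delta definition: the intervals [a i, b i] are non-overlapping,
   i.e., their interiors are pairwise disjoint.
   Functions on [s, t] are represented by total functions; the values outside
   [s, t] are irrelevant. *)
Definition absolutely_continuous (R : realType) (s t : R) (f : R -> R) : Prop :=
  forall e : R, 0 < e -> exists2 d : R, 0 < d &
    forall (n : nat) (a b : 'I_n -> R),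
      (forall i, s <= a i /\ a i <= b i /\ b i <= t) ->
      trivIset setT (fun i => [set` `]a i, b i[]) ->
      \sum_(i < n) (b i - a i) < d ->
      \sum_(i < n) `|f (b i) - f (a i)| < e.

(* An absolutely continuous x is differentiable almost everywhere in ]t0, T[,
   so that the values of derive1 x at the endpoints and at the points where x is not
   differentiable do not affect the integral. *)
Definition bolza_cost (R : realType) (L : R -> R -> R -> \bar R) (g : R -> R)
    (t0 T : R) (x : R -> R) : \bar R :=
  ((g (x T))%:E + \int[lebesgue_measure]_(t in `[t0, T]) L t (x t) (derive1 x t))%E.

Definition value_function (R : realType) (L : R -> R -> R -> \bar R)
    (g : R -> R) (T t0 x0 : R) : \bar R :=
  ereal_inf [set bolza_cost L g t0 T x |
               x in [set x : R -> R | absolutely_continuous t0 T x /\ x t0 = x0]].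

Definition phi (R : realType) (t x : R) : R :=
  Num.sqrt `|t - x| * expR (2 * Num.sqrt `|t - x|).

(* The formulas of phi, lagrangian and V make sense for every real time t;
   only the times of [0, T] are used. *)
Definition lagrangian (R : realType) (t x v : R) : \bar R :=
  if t == x then (if v == 0 then 0%E else +oo%E)
  else if `|v| <= 2 then (`|v| / (2 * phi t x))%:E else +oo%E.

Definition terminal_cost (R : realType) (T x : R) : R :=
  if T <= x then expR (- 2 * Num.sqrt (x - T)) - 1 else 1.

Definition V (R : realType) (T t x : R) : R :=
  if t <= x then expR (- 2 * Num.sqrt (x - t)) - 1
  else if 2 * t - T <= x then 1 - expR (- 2 * Num.sqrt (t - x))
  else 1.

(* Main.v *)
Require Import Defs.
From HB Require Import structures.
From mathcomp Require Import all_boot all_order all_algebra.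
From mathcomp Require Import finmap.
From mathcomp Require Import all_classical all_reals all_analysis measurable_realfun.
From mathcomp Require Import ring lra.

Set Implicit Arguments.
Unset Strict Implicit.
Unset Printing Implicit Defensive.

Import Order.TTheory GRing.Theory Num.Theory.
Import numFieldNormedType.Exports.

Local Open Scope classical_set_scope.
Local Open Scope ring_scope.

(** Write [y = x - t] for the signed distance of the state to the diagonal, and
    let [h y] be [exp (- 2 sqrt y) - 1] for [0 <= y], extended as an odd function.
    Then [V T t x = h (x - t)], except where [x < 2 * t - T], and
    [h' y = - 1 / phi]. Along a trajectory, the sum of the Lagrangian and of the
    derivative of [h (x t - t)] is [(`|v| - 2 * v + 2) / (2 * phi)]: it is
    nonnegative for [`|v| <= 2] and it vanishes for [v = 2]. So [h] decreases at
    most as fast as the running cost accumulates, and moving at speed 2 is optimal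
    as long as the diagonal can be reached in time; otherwise the terminal cost 1
    cannot be avoided and it is optimal to stay in place.

    The verification argument has two obstacles. First, [h] has an infinite slope
    at 0, so that [h (x t - t)] need not be absolutely continuous for a trajectory
    that meets the diagonal. It is replaced by the Lipschitz function
    [- potential r], obtained by shifting the argument of the square root by
    [r > 0]. Its slope is smaller in absolute value, so the inequality with the
    Lagrangian persists, even on the diagonal, where a nonzero speed costs [+oo];
    letting [r] tend to 0 in the integrated inequality gives the lower bound
    ([potential_le_running_cost]). The same regularization, combined with monotone
    convergence, computes the cost of the trajectories of speed 2 across the
    diagonal ([integral_lagrangian_double_speed]).

    Second, integrating the inequality requires the fundamental theorem of
    calculus for absolutely continuous functions, including their differentiability
    almost everywhere ([absolutely_continuous_FTC]). It is obtained by writing such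
    a function as a difference of nondecreasing absolutely continuous ones, by
    means of the total variation. The Stieltjes measure of a nondecreasing
    absolutely continuous function is dominated by the Lebesgue measure
    ([uniformly_ac_dominates]), so it has a Radon-Nikodym density, which is the
    derivative almost everywhere by Lebesgue's differentiation theorem. *)

(** * Absolute continuity and total variation *)

(** Indexing the intervals by an arbitrary finite type allows families that are
    naturally indexed by dependent pairs or by finite sets of intervals. *)
Lemma absolutely_continuous_fintype (R : realType) (s t : R) (f : R -> R) :
  absolutely_continuous s t f ->
  forall e, 0 < e -> exists2 d, 0 < d &
    forall (I : finType) (a b : I -> R),
      (forall i, s <= a i /\ a i <= b i /\ b i <= t) ->
      trivIset setT (fun i => [set` `]a i, b i[]) ->
      \sum_i (b i - a i) < d -> \sum_i `|f (b i) - f (a i)| < e.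
Proof.
move=> acf e e0; have [d d0 H] := acf _ e0; exists d => // I a b ab tab.
rewrite big_enum_val => sd.
rewrite [ltLHS]big_enum_val; apply: (H #|I| (a \o enum_val) (b \o enum_val)) => //.
  by move=> i; exact: ab.
move=> i j _ _ ij; apply: enum_val_inj; exact: (tab _ _ Logic.I Logic.I ij).
Qed.

Lemma absolutely_continuousB (R : realType) (s t : R) (f g : R -> R) :
  absolutely_continuous s t f -> absolutely_continuous s t g ->
  absolutely_continuous s t (f \- g).
Proof.
move=> acf acg e e0; have e20 : 0 < e / 2 by rewrite divr_gt0.
have [d d0 H] := acf _ e20; have [d' d'0 H'] := acg _ e20.
exists (Num.min d d'); first by rewrite lt_min d0.
move=> n a b ab tab; rewrite lt_min => /andP[abd abd'].
have := H n a b ab tab abd; have := H' n a b ab tab abd'.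
have : \sum_(i < n) `|(f \- g) (b i) - (f \- g) (a i)| <=
    \sum_(i < n) (`|f (b i) - f (a i)| + `|g (b i) - g (a i)|).
  apply: ler_sum => i _; rewrite (le_trans _ (ler_normB _ _))//= le_eqVlt.
  by apply/orP; left; apply/eqP; congr (`| _ |); ring.
rewrite big_split/=; lra.
Qed.

Lemma absolutely_continuous_id (R : realType) (s t : R) :
  absolutely_continuous s t (@id R).
Proof.
move=> e e0; exists e => // n a b ab _.
rewrite (eq_bigr (fun i => `|b i - a i|))// => i _.
by rewrite ger0_norm// subr_ge0; have [_ []] := ab i.
Qed.

Lemma absolutely_continuous_lipschitz (R : realType) (s t C : R) (k f : R -> R) :
  0 <= C -> (forall x y, `|k y - k x| <= C * `|y - x|) ->
  absolutely_continuous s t f -> absolutely_continuous s t (k \o f).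
Proof.
move=> C0 kC acf e e0.
have C1 : 0 < C + 1 by rewrite ltr_wpDl.
have [d d0 H] := acf _ (divr_gt0 e0 C1); exists d => // n a b ab tab abd.
have := H n a b ab tab abd; rewrite ltr_pdivlMr// mulrC.
apply: le_lt_trans; rewrite mulr_sumr; apply: ler_sum => i _ /=.
by rewrite (le_trans (kC _ _))// ler_wpM2r// lerDl.
Qed.

Lemma itv_partition_nth_le (R : realType) (a b : R) (r : seq R) :
  itv_partition a b r -> forall i j, (i <= j)%N -> (j <= size r)%N ->
  nth b (a :: r) i <= nth b (a :: r) j.
Proof.
move=> [ar _] i j ij jr.
have [->//|ne] := eqVneq i j.
apply: ltW; rewrite lt_sorted_ltn_nth ?inE//=.
- by rewrite ltn_neqAle ne ij.
- by rewrite ltnS (leq_trans ij).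
Qed.

Lemma itv_partition_nth_last (R : realType) (a b : R) (r : seq R) :
  itv_partition a b r -> nth b (a :: r) (size r) = b.
Proof. by move=> [_ /eqP]; rewrite (last_nth b). Qed.

(** The cells of all the partitions form, together, one finite family of
    non-overlapping intervals with the same total length as the intervals they
    subdivide, so that absolute continuity applies to the family of cells. *)
Lemma absolutely_continuous_variation (R : realType) (s t : R) (f : R -> R) :
  absolutely_continuous s t f ->
  forall e, 0 < e -> exists2 d, 0 < d &
    forall (n : nat) (a b : 'I_n -> R) (r : 'I_n -> seq R),
      (forall i, s <= a i /\ a i <= b i /\ b i <= t) ->
      (forall i, itv_partition (a i) (b i) (r i)) ->
      trivIset setT (fun i => [set` `]a i, b i[]) ->
      \sum_i (b i - a i) < d -> \sum_i variation (a i) (b i) f (r i) < e.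
Proof.
move=> acf e e0; have [d d0 H] := absolutely_continuous_fintype acf e0.
exists d => // n a b r ab abr tab abd.
pose p i k := nth (b i) (a i :: r i) k.
pose J i := 'I_(size (r i)).
have ap i k : (k <= size (r i))%N -> a i <= p i k.
  by move=> kr; exact: (itv_partition_nth_le (abr i) (leq0n _)).
have pb i k : (k <= size (r i))%N -> p i k <= b i.
  move=> kr; rewrite -[leRHS](itv_partition_nth_last (abr i)).
  exact: (itv_partition_nth_le (abr i)).
have := H {i : 'I_n & J i} (fun u => p (tag u) (tagged u))
  (fun u => p (tag u) (tagged u).+1).
have E (F : R -> R -> R) :
    \sum_(u : {i : 'I_n & J i}) F (p (tag u) (tagged u)) (p (tag u) (tagged u).+1)
    = \sum_i \sum_(0 <= k < size (r i)) F (p i k) (p i k.+1).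
  under [RHS]eq_bigr do rewrite big_mkord.
  by rewrite sig_big_dep.
rewrite (E (fun x y => y - x)) (E (fun x y => `|f y - f x|)).
apply.
- move=> [i k] /=; have [ai [_ bi]] := ab i.
  split; first by rewrite (le_trans ai)// ap// ltnW.
  split; last by rewrite (le_trans _ bi)// pb.
  exact: (itv_partition_nth_le (abr i)).
- move=> [i k] [j l] _ _ /= [x []]; rewrite /= !in_itv/= => /andP[x1 x2] /andP[x3 x4].
  have ij : i = j.
    apply: tab => //; exists x; split; rewrite /= in_itv/=; apply/andP; split.
    - exact: le_lt_trans (ap _ _ (ltnW (ltn_ord k))) x1.
    - exact: lt_le_trans x2 (pb _ _ (ltn_ord k)).
    - exact: le_lt_trans (ap _ _ (ltnW (ltn_ord l))) x3.
    - exact: lt_le_trans x4 (pb _ _ (ltn_ord l)).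
  subst j; congr existT; apply/val_inj => /=.
  case: (ltngtP k l) => // kl.
    have := itv_partition_nth_le (abr i) kl (ltnW (ltn_ord l)).
    by move=> /(lt_le_trans x2) /lt_trans => /(_ _ x3); rewrite ltxx.
  have := itv_partition_nth_le (abr i) kl (ltnW (ltn_ord k)).
  by move=> /(lt_le_trans x4) /lt_trans => /(_ _ x1); rewrite ltxx.
- rewrite (le_lt_trans _ abd)// ler_sum// => i _.
  by rewrite telescope_sumr// /p itv_partition_nth_last.
Qed.

(** The variation on an interval shorter than the modulus for [e = 1] is at
    most 1, and finitely many such intervals cover the given one. *)
Lemma absolutely_continuous_total_variation_fin_num (R : realType) (s t : R)
    (f : R -> R) :
  absolutely_continuous s t f -> forall x y, s <= x -> x <= y -> y <= t ->
  total_variation x y f \is a fin_num.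
Proof.
move=> acf.
have [d d0 H] := absolutely_continuous_variation acf ltr01.
have small x y : s <= x -> x <= y -> y <= t -> y - x < d ->
    total_variation x y f \is a fin_num.
  move=> sx xy yt yxd; apply/bounded_variationP => //.
  exists 1 => _ [r xyr <-]; apply/ltW.
  have := H 1%N (fun=> x) (fun=> y) (fun=> r); rewrite !big_ord1; apply => //.
  by move=> i j _ _ _; rewrite !ord1.
suff main n x y : s <= x -> x <= y -> y <= t -> y - x < d / 2 * n%:R ->
    total_variation x y f \is a fin_num.
  move=> x y sx xy yt; apply: (main (Num.bound ((y - x) / (d / 2))) x y) => //.
  rewrite mulrC -ltr_pdivrMr ?divr_gt0//.
  by apply: archi_boundP; rewrite divr_ge0 ?subr_ge0// divr_ge0// ltW.
elim: n x y => [|n IH] x y sx xy yt.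
  by rewrite mulr0 subr_lt0 ltNge xy.
rewrite -[n.+1%:R]natr1 mulrDr mulr1 => yxn.
have [yxd|yxd] := ltP (y - x) d; first exact: small.
have xc : x <= y - d / 2 by lra.
have cy : y - d / 2 <= y by lra.
rewrite (total_variationD f xc cy) fin_numD IH ?small//; lra.
Qed.

(** On each interval of a short family, the increment of the total variation is
    nearly the variation along a well-chosen partition; the sum of the latter is
    controlled by [absolutely_continuous_variation]. *)
Lemma absolutely_continuous_total_variation (R : realType) (s t : R) (f : R -> R) :
  absolutely_continuous s t f ->
  absolutely_continuous s t (fun x => fine (total_variation s x f)).
Proof.
move=> acf e e0.
have e20 : 0 < e / 2 by rewrite divr_gt0.
have [d d0 H] := absolutely_continuous_variation acf e20.
exists d => // n a b ab tab abd.
have TVE i : fine (total_variation s (b i) f) - fine (total_variation s (a i) f) =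
    fine (total_variation (a i) (b i) f).
  have [ai [aibi bi]] := ab i.
  rewrite (total_variationD f ai aibi) fineD; first lra.
  - apply: (absolutely_continuous_total_variation_fin_num acf) => //; lra.
  - exact: (absolutely_continuous_total_variation_fin_num acf).
(* The n partitions share the remaining half of e; the successor avoids a
   division by zero for an empty family. *)
pose c := e / 2 / n.+1%:R.
have c0 : 0 < c by rewrite divr_gt0.
have /choice[r Hr] i : exists r, itv_partition (a i) (b i) r /\
    fine (total_variation (a i) (b i) f) < variation (a i) (b i) f r + c.
  have [ai [aibi bi]] := ab i.
  have fin := absolutely_continuous_total_variation_fin_num acf ai aibi bi.
  have [_ [_ [r abr <-] <-] Hr] := ub_ereal_sup_adherent c0 fin.
  exists r; split => //.
  by rewrite -lte_fin fineK// EFinD -lteBlDr.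
have := H n a b r ab (fun i => (Hr i).1) tab abd.
move=> Hlt.
have Hn : c * n%:R < e / 2.
  rewrite /c mulrAC ltr_pdivrMr// ltr_pM2l// ltr_nat//.
have : \sum_(i < n) `|fine (total_variation s (b i) f) - fine (total_variation s (a i) f)|
   <= \sum_(i < n) (variation (a i) (b i) f (r i) + c).
  apply: ler_sum => i _; rewrite TVE ger0_norm; first exact/ltW/(Hr i).2.
  by have [_ [? _]] := ab i; apply: fine_ge0; exact: total_variation_ge0.
rewrite big_split/= sumr_const card_ord -mulr_natr; lra.
Qed.

(** * Lebesgue-Stieltjes measure of an absolutely continuous function *)

(** Absolute continuity on the whole line, with one modulus valid everywhere; it
    holds for an absolutely continuous function of a segment extended by
    constants. *)
Definition uniformly_ac (R : realType) (G : R -> R) : Prop :=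
  forall e, 0 < e -> exists2 d, 0 < d &
    forall (I : finType) (a b : I -> R), (forall i, a i <= b i) ->
      trivIset setT (fun i => [set` `]a i, b i[]) ->
      \sum_i (b i - a i) < d -> \sum_i `|G (b i) - G (a i)| < e.

Lemma lebesgue_stieltjes_itvoc (R : realType) (G : cumulative R R) (a b : R) :
  a <= b -> lebesgue_stieltjes_measure G `]a, b] = (G b - G a)%:E.
Proof.
move=> ab; rewrite /lebesgue_stieltjes_measure /measure_extension.
rewrite measurable_mu_extE/=; last exact: is_ocitv.
by rewrite (wlength_itv_bnd G false false ab).
Qed.

(** A set of the ring generated by the half-open intervals is a finite disjoint
    union of such intervals, on which both measures are sums of increments, so
    that the [e]-[d] condition on [G] says exactly what is claimed up to
    strictness. *)
Lemma uniformly_ac_lebesgue_stieltjes_ring (R : realType) (G : cumulative R R)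
    (e d : R) :
  (forall (I : finType) (a b : I -> R), (forall i, a i <= b i) ->
      trivIset setT (fun i => [set` `]a i, b i[]) ->
      \sum_i (b i - a i) < d -> \sum_i `|G (b i) - G (a i)| < e) ->
  forall U : set R,
  (R.-ocitv.-ring).-measurable (U : set (SetRing.type (ocitv_type R))) ->
  (lebesgue_measure U < d%:E)%E -> (lebesgue_stieltjes_measure G U <= e%:E)%E.
Proof.
move=> H U mU Ud.
pose B := SetRing.decomp (U : set (SetRing.type (ocitv_type R))).
have Bfin : finite_set B by exact: SetRing.decomp_finite_set.
have tB : trivIset B id by exact: SetRing.decomp_triv.
have UB : U = \bigcup_(X in B) X by rewrite SetRing.cover_decomp.
have /choice[ab Hab] (X : set R) : exists ab : R * R,
    B X -> ab.1 <= ab.2 /\ X = `]ab.1, ab.2]%classic.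
  have [BX|nBX] := pselect (B X); last by exists (0, 0).
  have : ocitv X by exact: (SetRing.decomp_measurable mU (mem_set BX)).
  move=> /ocitvP[->|[p p12 ->]].
    by exists (0, 0) => _; split=> //=; rewrite set_itvoc0.
  by exists p => _; split=> //; exact: ltW.
have mB X : B X -> measurable (X : set (measurableTypeR R)).
  by move=> /Hab[_ ->]; apply: sub_sigma_algebra; exact: is_ocitv.
have muU (F : cumulative R R) : lebesgue_stieltjes_measure F U =
    (\sum_(X : fset_set B) (F (ab (val X)).2 - F (ab (val X)).1))%:E.
  rewrite UB measure_fin_bigcup//.
  rewrite fsbig_finite//= -sumEFin big_seq_fsetE/=.
  apply: eq_bigr => X _.
  have BX : B (val X) by have := fsvalP X; rewrite in_fset_set// inE.
  have [le12 E] := Hab _ BX.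
  by rewrite {1}E lebesgue_stieltjes_itvoc.
move: Ud; rewrite /lebesgue_measure !muU lte_fin lee_fin => Ud.
have BX (X : fset_set B) : B (val X).
  by have := fsvalP X; rewrite in_fset_set// inE.
apply: le_trans (ltW (H _ (fun X : fset_set B => (ab (val X)).1)
  (fun X => (ab (val X)).2) _ _ Ud)).
- by apply: ler_sum => X _; exact: ler_norm.
- by move=> X; have [] := Hab _ (BX X).
- move=> X Y _ _ [x [/= x1 x2]]; apply/val_inj/tB => //.
  exists x; split; rewrite /=.
    by have [_ ->] := Hab _ (BX X); apply: subset_itv_oo_oc.
  by have [_ ->] := Hab _ (BX Y); apply: subset_itv_oo_oc.
Qed.

(** A null set has a countable cover by half-open intervals of small total
    length. The finite partial unions lie in the ring of intervals, hence have
    small Stieltjes measure, and so does the whole cover by continuity from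
    below. *)
Lemma uniformly_ac_dominates (R : realType) (G : cumulative R R) :
  uniformly_ac G -> lebesgue_stieltjes_measure G `<< lebesgue_measure.
Proof.
move=> acG; apply/null_content_dominatesP => N mN N0.
apply/eqP; rewrite eq_le measure_ge0 andbT; apply/lee_addgt0Pr => e e0.
rewrite add0e.
have [d d0 H] := acG _ e0.
have : (lebesgue_measure N < d%:E)%E by rewrite N0 lte_fin.
move=> /ereal_inf_lt[_ [/= A [mA NA] <-] Ad].
have mA' k : measurable (A k : set (measurableTypeR R)).
  exact: sub_sigma_algebra.
have mringU n : (R.-ocitv.-ring).-measurable
    (\big[setU/set0]_(k < n) A k : set (SetRing.type (ocitv_type R))).
  apply: bigsetU_measurable => k _; exact: SetRing.measurable_subring.
have mU n : measurable
    (\big[setU/set0]_(k < n) A k : set (measurableTypeR R)).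
  by apply: bigsetU_measurable => k _.
have small n : (lebesgue_stieltjes_measure G (\big[setU/set0]_(k < n) A k) <= e%:E)%E.
  apply: (uniformly_ac_lebesgue_stieltjes_ring H) => //.
  apply: le_lt_trans Ad.
  apply: (@le_trans _ _ (\sum_(k < n) lebesgue_measure (A k))%E).
    exact: Boole_inequality.
  rewrite -(big_mkord xpredT (fun k => lebesgue_measure (A k))).
  under eq_bigr.
    move=> k _; rewrite /lebesgue_measure /lebesgue_stieltjes_measure /measure_extension.
    rewrite measurable_mu_extE//.
    over.
  exact: nneseries_lim_ge.
have mUA : measurable (\bigcup_k A k : set (measurableTypeR R)).
  exact: bigcup_measurable.
apply: (@le_trans _ _ (lebesgue_stieltjes_measure G (\bigcup_k A k))).
  by apply: le_measure => //; rewrite inE.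
rewrite -bigcup_bigsetU_bigcup.
have cv : lebesgue_stieltjes_measure G (\big[setU/set0]_(k < n.+1) A k) @[n --> \oo]
    --> lebesgue_stieltjes_measure G (\bigcup_n \big[setU/set0]_(k < n.+1) A k).
  apply: nondecreasing_cvg_mu => //; first by rewrite bigcup_bigsetU_bigcup.
  by move=> m n mn; apply/subsetPset; exact: subset_bigsetU.
rewrite -(cvg_lim _ cv)//; apply: lime_le; first exact: cvgP cv.
by apply: nearW => n; exact: small.
Qed.

Lemma uniformly_ac_continuous (R : realType) (G : R -> R) :
  uniformly_ac G -> continuous G.
Proof.
move=> acG x; apply/cvgrPdist_lt => e e0.
have [d d0 H] := acG _ e0.
near=> y.
have : `|x - y| < d by near: y; exact: cvgr_dist_lt.
have tI (a b : R) : trivIset setT (fun i : 'I_1 => [set` `]a, b[]).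
  by move=> i j _ _ _; rewrite !ord1.
have := @H 'I_1 (fun=> Num.min x y) (fun=> Num.max x y) _ (tI _ _).
rewrite !big_ord1; have [xy|xy] := leP x y.
  by move=> /(_ (fun=> xy)) h; rewrite distrC ger0_norm ?subr_ge0// distrC => /h.
by move=> /(_ (fun=> ltW xy)) h; rewrite ger0_norm ?subr_ge0 ?ltW// => /h.
Unshelve. all: by end_near. Qed.

Definition clamp (R : realType) (s t x : R) : R := Num.max s (Num.min t x).

Lemma clamp_id (R : realType) (s t x : R) : s <= x <= t -> clamp s t x = x.
Proof. by move=> /andP[sx xt]; rewrite /clamp min_r// max_r. Qed.

Lemma clamp_itv (R : realType) (s t x : R) : s <= t -> s <= clamp s t x <= t.
Proof. by move=> st; rewrite /clamp le_max lexx/= ge_max st ge_min lexx. Qed.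

Lemma clamp_homo (R : realType) (s t : R) : {homo clamp s t : x y / x <= y}.
Proof.
move=> x y xy; rewrite /clamp ge_max !le_max lexx/=; apply/orP; right.
by rewrite le_min !ge_min lexx xy orbT.
Qed.

Lemma clamp_sub (R : realType) (s t x y : R) : x <= y ->
  clamp s t y - clamp s t x <= y - x.
Proof.
by move=> xy; rewrite /clamp; case: (leP t x) => ?; case: (leP t y) => ?;
  rewrite ?maxEle; do ?case: ifP => ?; lra.
Qed.

(** Clamping the endpoints of disjoint intervals therefore leaves them
    disjoint. *)
Lemma clamp_itvoo (R : realType) (s t a b x : R) : s <= t ->
  x \in `]clamp s t a, clamp s t b[ -> x \in `]a, b[.
Proof.
move=> st; rewrite !in_itv/= => /andP[ax xb].
have /andP[sb bt] := clamp_itv b st; have /andP[sa atx] := clamp_itv a st.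
have x_id : clamp s t x = x by rewrite clamp_id//; lra.
apply/andP; split; rewrite ltNge; apply/negP => /(clamp_homo s t);
  rewrite x_id; lra.
Qed.

Lemma absolutely_continuous_clamp (R : realType) (s t : R) (f : R -> R) :
  s <= t -> absolutely_continuous s t f -> uniformly_ac (f \o clamp s t).
Proof.
move=> st acf e e0; have [d d0 H] := absolutely_continuous_fintype acf e0.
exists d => // I a b ab tab abd; apply: H.
- move=> i; have /andP[-> _] := clamp_itv (a i) st.
  by have /andP[_ ->] := clamp_itv (b i) st; rewrite clamp_homo.
- move=> i j _ _ [x [/= xi xj]]; apply: tab => //.
  by exists x; split => /=; [exact: (clamp_itvoo st xi)|exact: (clamp_itvoo st xj)].
- by rewrite (le_lt_trans _ abd)// ler_sum// => i _; exact: clamp_sub.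
Qed.

(** * Fundamental theorem of calculus for absolutely continuous functions *)

(** The density is the Radon-Nikodym derivative, with respect to the Lebesgue
    measure, of the Stieltjes measure of [G] restricted to [`]s, t]]; since [G] is
    constant outside of the segment, the formula holds for every [x]. *)
Lemma nondecreasing_ac_density (R : realType) (s t : R) (G : R -> R) :
  s <= t -> {homo G : x y / x <= y} -> uniformly_ac G ->
  (forall x, G x = G (clamp s t x)) ->
  exists2 g : R -> R, lebesgue_measure.-integrable setT (EFin \o g) &
    forall x, (\int[lebesgue_measure]_(y in `]-oo, x]) (g y)%:E = (G x - G s)%:E)%E.
Proof.
move=> st ndG acG Gclamp.
pose Gc : cumulative R R := HB.pack G (isCumulative.Build R _ R G ndG
  (right_continuousW (uniformly_ac_continuous acG))).
have mD : measurable (`]s, t]%classic : set (measurableTypeR R)).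
  by apply: sub_sigma_algebra; exact: is_ocitv.
have Dfin : (lebesgue_stieltjes_measure Gc `]s, t]%classic < +oo)%E.
  by rewrite lebesgue_stieltjes_itvoc// ltry.
pose nu : {finite_measure set (measurableTypeR R) -> \bar R} := mfrestr mD Dfin.
have nu_mu : nu `<< @lebesgue_measure R.
  apply/null_content_dominatesP => A mA A0.
  have /null_content_dominatesP dom := uniformly_ac_dominates (G := Gc) acG.
  apply: dom; first exact: measurableI.
  by apply: (subset_measure0 _ _ _ A0) => //; exact: measurableI.
have [f [f0 ffin fint fE]] := radon_nikodym_sigma_finite nu_mu.
have Ef : EFin \o (fine \o f) = f by apply/funext => x /=; rewrite fineK.
exists (fine \o f); first by rewrite Ef.
move=> x; under eq_integral do rewrite /= fineK//.
rewrite -fE; last exact: measurable_itv.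
rewrite /nu/= /mfrestr/= /mrestr/=.
have -> : `]-oo, x] `&` `]s, t] = `]s, clamp s t x]%classic.
  apply/seteqP; split=> y /=; rewrite !in_itv/= /clamp le_max le_min.
    by move=> [-> /andP[-> ->]]; rewrite orbT.
  by move=> /andP[sy]; rewrite leNgt sy/= => /andP[-> ->].
have /andP[sx _] := clamp_itv x st.
by rewrite lebesgue_stieltjes_itvoc//= -Gclamp EFinB.
Qed.

(** An absolutely continuous function is the difference of two nondecreasing
    absolutely continuous functions, its total variation [P] and [P - f]; both
    have a density, and Lebesgue differentiation identifies the difference [g] of
    the densities with the derivative of [f] almost everywhere. *)
Lemma absolutely_continuous_FTC (R : realType) (s t : R) (f : R -> R) :
  s <= t -> absolutely_continuous s t f ->
  exists g : R -> R,
    [/\ lebesgue_measure.-integrable setT (EFin \o g),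
        (\int[lebesgue_measure]_(y in `]s, t]) (g y)%:E = (f t - f s)%:E)%E &
        {ae lebesgue_measure, forall x : R, s < x < t ->
          derivable f x 1 /\ derive1 f x = g x}].
Proof.
move=> st acf.
pose P x := fine (total_variation s x f).
have acP : absolutely_continuous s t P by exact: absolutely_continuous_total_variation.
have acN : absolutely_continuous s t (P \- f) by exact: absolutely_continuousB.
have Pfin x y : s <= x -> x <= y -> y <= t ->
    total_variation x y f \is a fin_num.
  exact: absolutely_continuous_total_variation_fin_num.
have PB x y : s <= x -> x <= y -> y <= t -> `|f y - f x| <= P y - P x.
  move=> sx xy yt; rewrite /P (total_variationD f sx xy).
  rewrite fineD ?Pfin//; [|lra..].
  rewrite [leRHS]addrC addKr -lee_fin fineK ?Pfin//.
  exact: total_variation_ge.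
have ndP : {homo P \o clamp s t : x y / x <= y}.
  move=> x y xy /=; have /andP[sx xt] := clamp_itv x st.
  have /andP[sy yt] := clamp_itv y st.
  by rewrite -subr_ge0 (le_trans _ (PB _ _ _ _ _))// clamp_homo.
have ndN : {homo (P \- f) \o clamp s t : x y / x <= y}.
  move=> x y xy /=; have /andP[sx xt] := clamp_itv x st.
  have /andP[sy yt] := clamp_itv y st.
  have := PB _ _ sx (clamp_homo s t xy) yt.
  have := ler_norm (f (clamp s t y) - f (clamp s t x)); lra.
have clampK (h : R -> R) x : (h \o clamp s t) x = (h \o clamp s t) (clamp s t x).
  by rewrite /= [clamp s t (clamp _ _ _)]clamp_id// clamp_itv.
have [p intp pE] := nondecreasing_ac_density st ndP
  (absolutely_continuous_clamp st acP) (clampK P).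
have [q intq qE] := nondecreasing_ac_density st ndN
  (absolutely_continuous_clamp st acN) (clampK (P \- f)).
pose g x := p x - q x.
have intg : lebesgue_measure.-integrable setT (EFin \o g).
  have -> : EFin \o g = ((EFin \o p) \- (EFin \o q))%E by [].
  exact: integrableB.
have intS (h : R -> R) A : measurable A ->
    lebesgue_measure.-integrable setT (EFin \o h) ->
    lebesgue_measure.-integrable A (EFin \o h).
  by move=> mA; apply: integrableS.
have gE x : (\int[lebesgue_measure]_(y in `]-oo, x]) (g y)%:E =
    (f (clamp s t x) - f s)%:E)%E.
  under eq_integral do rewrite EFinB.
  rewrite integralB//=; [|exact: intS..].
  rewrite pE qE/= -EFinB; congr EFin.
  have -> : clamp s t s = s by rewrite clamp_id// lexx.
  ring.
exists g; split => //.
- have := gE t; rewrite clamp_id ?lexx ?st//.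
  have := gE s; rewrite clamp_id ?lexx ?st// subrr => gs.
  rewrite (@itv_bndbnd_setU _ _ _ (BRight s)) ?bnd_simp//.
  rewrite integral_setU_EFin//=.
  + by rewrite gs add0e.
  + by apply/measurable_EFinP; apply: measurable_int (intS _ _ _ intg); exact: measurableU.
  + apply/disj_set2P; apply/seteqP; split => // x [/=]; rewrite !in_itv/= => xs /andP[sx _].
    by move: (lt_le_trans sx xs); rewrite ltxx.
- have locg : locally_integrable [set: R] g.
    by have := integrable_locally measurableT intg; rewrite patch_setT.
  have := FTC1Ny (fun y => intS _ _ (measurable_itv _) intg) locg.
  apply: filterS; first exact: (ae_filter_ringOfSetsType lebesgue_measure).
  move=> x [].
  set F := (fun x : R => _) => dF F'g /andP[sx xt].
  have FE y : F y = f (clamp s t y) - f s := congr1 fine (gE y).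
  have fF : {near x, f =1 F \+ cst (f s)}.
    near=> y; rewrite /= FE clamp_id ?subrK//.
    apply/andP; split; near: y; [exact: lt_le_nbhsr|exact: lt_le_nbhsl].
  have iF : is_derive x 1 F (g x) by apply: (DeriveDef dF); move: F'g; rewrite derive1E.
  have iFc : is_derive x 1 (F \+ cst (f s)) (g x).
    by rewrite -[g x]addr0; exact: is_deriveD.
  have [df fE] : is_derive x 1 f (g x).
    by apply: near_eq_is_derive iFc; apply: filterS fF => y.
  by rewrite derive1E.
Unshelve. all: by end_near. Qed.

(** * Lower bounds for integrals of possibly non-measurable functions *)

(** The integral of a nonnegative function is a supremum of integrals of simple
    functions below it, hence it is monotone without any measurability. This is
    what allows the running cost of a trajectory, whose derivative is an
    arbitrary function on a null set, to be bounded from below. *)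
Lemma le_integral_nonmeasurable d (T : measurableType d) (R : realType)
    (mu : {measure set T -> \bar R}) (D1 D2 : set T) (f1 f2 : T -> \bar R) :
  D1 `<=` D2 -> (forall x, D1 x -> 0 <= f1 x <= f2 x)%E ->
  (forall x, D2 x -> 0 <= f2 x)%E ->
  (\int[mu]_(x in D1) f1 x <= \int[mu]_(x in D2) f2 x)%E.
Proof.
move=> D12 f12 f2_ge0; rewrite integral_mkcond [leRHS]integral_mkcond.
have p1 x : (0 <= (f1 \_ D1) x <= (f2 \_ D2) x)%E.
  rewrite !patchE; case: ifPn => [/set_mem D1x|_].
    by rewrite mem_set ?f12//; exact: D12.
  by rewrite lexx/=; case: ifPn => // /set_mem/f2_ge0.
rewrite ge0_integralTE; last by move=> x; have /andP[] := p1 x.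
rewrite ge0_integralTE; last first.
  by move=> x; have /andP[p q] := p1 x; exact: le_trans p q.
apply: le_ereal_sup => _ [h hf <-]; exists h => // x.
by apply: le_trans (hf x) _; have /andP[] := p1 x.
Qed.

(** The density of [F] is below [K] outside of a null set; that set can be
    removed from the integral of the density, which is measurable, before the
    comparison with [K], which need not be. *)
Lemma absolutely_continuous_le_integral (R : realType) (s t : R) (F : R -> R)
    (K : R -> \bar R) :
  s <= t -> absolutely_continuous s t F ->
  (forall x : R, s <= x <= t -> (0 <= K x)%E) ->
  {ae lebesgue_measure, forall x : R, s < x < t -> derivable F x 1 ->
    ((derive1 F x)%:E <= K x)%E} ->
  ((F t - F s)%:E <= \int[lebesgue_measure]_(x in `[s, t]) K x)%E.
Proof.
move=> st acF K0 FK; have [g [intg gE dF]] := absolutely_continuous_FTC st acF.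
have [N [mN N0 HN]] : {ae lebesgue_measure, forall x : R, s < x < t ->
    ((g x)%:E <= K x)%E}.
  apply: filterS2 FK dF; first exact: (ae_filter_ringOfSetsType lebesgue_measure).
  by move=> x Kx gx sxt; have [dFx <-] := gx sxt; exact: Kx.
have intp := integrable_funepos measurableT intg.
have mD : measurable (`]s, t]%classic : set (measurableTypeR R)).
  exact: measurable_itv.
have mt : measurable ([set t] : set (measurableTypeR R)) by exact: measurable_set1.
have mM : measurable (N `|` [set t] : set (measurableTypeR R)).
  exact: measurableU.
have M0 : lebesgue_measure (N `|` [set t] : set (measurableTypeR R)) = 0%E.
  by apply: null_set_setU => //; exact: lebesgue_measure_set1.
rewrite -gE.
apply: (@le_trans _ _ (\int[lebesgue_measure]_(x in `]s, t]) (EFin \o g)^\+ x)%E).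
  apply: le_integral => //; [exact: integrableS intg|exact: integrableS intp|].
  by move=> x _; rewrite funeposE le_max lexx.
rewrite (negligible_integral mM mD _ M0); last exact: integrableS intp.
apply: le_integral_nonmeasurable.
- by move=> x [+ _]; rewrite /= !in_itv/= => /andP[/ltW -> ->].
- move=> x [+ /not_orP[Nx xt]]; rewrite /= in_itv/= => /andP[sx xt'].
  have {xt'}xt : x < t by rewrite lt_neqAle xt' andbT; apply/eqP.
  rewrite funepos_ge0/= funeposE ge_max K0 ?andbT; last by rewrite !ltW.
  apply: contrapT => gK; apply: Nx; apply: HN => /= /(_ _)gK'; apply: gK.
  by apply: gK'; rewrite sx.
- by move=> x /=; rewrite in_itv/=; exact: K0.
Qed.

(** * The regularized value function *)

Definition decay (R : realType) (s : R) : R := expR (- 2 * Num.sqrt s).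

(** With [s = `|t - x|] this is [1 / phi t x]. *)
Definition decay_rate (R : realType) (s : R) : R := decay s / Num.sqrt s.

(** For [r = 0] and where [2 * t - T <= x], this is minus the value function at
    [(t, x)], written in terms of [y = x - t]; its slope is infinite at [y = 0]. For [r > 0] it is a
    continuously differentiable and Lipschitz odd function of [y], whose slope at
    [y] is [decay_rate (`|y| + r)]. *)
Definition potential (R : realType) (r y : R) : R :=
  Num.sg y * (decay r - decay (`|y| + r)).

Lemma is_derive_decay (R : realType) (s : R) : 0 < s ->
  is_derive s 1 (@decay R) (- decay_rate s).
Proof.
move=> s0; have h : is_derive s 1 (fun x : R => - 2 * Num.sqrt x)
    (- 2 * (2 * Num.sqrt s)^-1).
  exact: is_deriveZ (is_derive1_sqrt s0).
have := @is_derive1_comp R expR (fun x => - 2 * Num.sqrt x) s _ _ (is_derive_expR _) h.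
move=> hs; apply: (is_derive_eq hs); rewrite /decay_rate /decay.
have sN0 : Num.sqrt s != 0 by rewrite gt_eqF// sqrtr_gt0.
by field.
Qed.

Lemma continuous_decay (R : realType) : continuous (@decay R).
Proof.
move=> s; apply: (@continuous_comp _ _ _ (fun x : R => - 2 * Num.sqrt x) expR).
  by apply: continuousM; [exact: cst_continuous|exact: sqrt_continuous].
exact: continuous_expR.
Qed.

Lemma decay_nincr (R : realType) : {homo @decay R : x y /~ x <= y}.
Proof.
move=> x y xy; rewrite /decay ler_expR !mulNr lerN2 ler_pM2l//.
exact: ler_wsqrtr.
Qed.

Lemma decay_le1 (R : realType) (s : R) : decay s <= 1.
Proof. by rewrite /decay expR_le1 mulNr oppr_le0 mulr_ge0// sqrtr_ge0. Qed.

Lemma decay_rate_ge0 (R : realType) (s : R) : 0 <= decay_rate s.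
Proof. by rewrite /decay_rate divr_ge0// ?expR_ge0// sqrtr_ge0. Qed.

Lemma decay_rate_nincr (R : realType) (x y : R) : 0 < x -> x <= y ->
  decay_rate y <= decay_rate x.
Proof.
move=> x0 xy; have y0 := lt_le_trans x0 xy.
rewrite /decay_rate; apply: ler_pM; rewrite ?expR_ge0 ?invr_ge0 ?sqrtr_ge0//.
  exact: decay_nincr.
by rewrite lef_pV2 ?posrE ?sqrtr_gt0// ler_wsqrtr.
Qed.

Lemma continuous_decay_rate (R : realType) (s : R) : 0 < s ->
  {for s, continuous (@decay_rate R)}.
Proof.
move=> s0; apply: continuousM; first exact: continuous_decay.
apply: continuousV; last exact: sqrt_continuous.
by rewrite gt_eqF// sqrtr_gt0.
Qed.

Lemma potentialN (R : realType) (r y : R) : potential r (- y) = - potential r y.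
Proof. by rewrite /potential sgrN normrN mulNr. Qed.

Lemma is_derive_potential_pos (R : realType) (r y : R) : 0 <= r -> 0 < y ->
  is_derive y 1 (potential r) (decay_rate (y + r)).
Proof.
move=> r0 y0.
have h1 : is_derive y 1 (fun z : R => z + r) 1.
  by rewrite -[1 in X in is_derive _ _ _ X]addr0; exact: is_deriveD.
have yr0 : 0 < y + r by rewrite ltr_pwDl.
have h2 := @is_derive1_comp R (@decay R) (fun z => z + r) y _ _
  (is_derive_decay yr0) h1.
have h3 := is_deriveB (is_derive_cst (decay r) y 1) h2.
have h4 : is_derive y 1 (cst (decay r) \- (@decay R \o (fun z : R => z + r)))
    (decay_rate (y + r)).
  by apply: (is_derive_eq h3); rewrite mulr1 sub0r opprK.
apply: near_eq_is_derive h4; near=> z.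
have z0 : 0 < z by near: z; exact: lt_nbhsr.
by rewrite /potential gtr0_sg// mul1r gtr0_norm.
Unshelve. all: by end_near. Qed.

Lemma is_derive_potential_neg (R : realType) (r y : R) : 0 <= r -> y < 0 ->
  is_derive y 1 (potential r) (decay_rate (- y + r)).
Proof.
move=> r0 y0; have Ny0 : 0 < - y by rewrite oppr_gt0.
have h := is_deriveN (@is_derive1_comp R (potential r) -%R y _ _
  (is_derive_potential_pos r0 Ny0) (is_deriveNid y 1)).
have -> : potential r = - (potential r \o -%R).
  by apply/funext => z /=; rewrite fctE/= potentialN opprK.
by apply: (is_derive_eq h); rewrite mulrN1 opprK.
Qed.

(** [potential r] is odd and coincides with a differentiable function for
    positive arguments; its Caratheodory slope function at the origin is that of
    [decay] at [r], composed with the absolute value. *)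
Lemma is_derive_potential0 (R : realType) (r : R) : 0 < r ->
  is_derive (0 : R) 1 (potential r) (decay_rate r).
Proof.
move=> r0; have := is_derive_decay r0.
move=> /is_derive1_caratheodory [g [gE gc gr]].
apply/is_derive1_caratheodory; exists (fun y => - g (`|y| + r)); split.
- move=> y; rewrite /potential sgr0 mul0r !subr0 -opprB gE addrK.
  by rewrite [X in _ = _ * X]numEsg; ring.
- apply: continuousN; apply: continuous_comp; last by rewrite normr0 add0r.
  apply: continuousD; last exact: cst_continuous.
  exact: norm_continuous.
- by rewrite normr0 add0r gr opprK.
Qed.

Lemma is_derive_potential (R : realType) (r y : R) : 0 < r ->
  is_derive y 1 (potential r) (decay_rate (`|y| + r)).
Proof.
move=> r0; have [y0|y0|->] := ltgtP y 0.
- by rewrite ltr0_norm//; apply: is_derive_potential_neg => //; exact: ltW.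
- by rewrite gtr0_norm//; apply: is_derive_potential_pos => //; exact: ltW.
- by rewrite normr0 add0r; exact: is_derive_potential0.
Qed.

(** The slope of [potential r] is largest at the origin, where it equals
    [decay_rate r]. *)
Lemma potential_lipschitz (R : realType) (r x y : R) : 0 < r ->
  `|potential r y - potential r x| <= decay_rate r * `|y - x|.
Proof.
move=> r0; wlog xy : x y / x <= y => [H|].
  have [xy|/ltW yx] := leP x y; first exact: H.
  by rewrite distrC [in leRHS]distrC; exact: H.
have dP (z : R) : is_derive z 1 (potential r) (decay_rate (`|z| + r)).
  exact: is_derive_potential.
have [|c _ ->] := MVT_segment xy (fun z _ => dP z).
  apply: continuous_subspaceT => z; apply: differentiable_continuous.
  by apply/derivable1_diffP; have [] := dP z.
rewrite normrM ler_wpM2r// ger0_norm ?decay_rate_ge0//.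
by apply: decay_rate_nincr => //; rewrite lerDr.
Qed.

Lemma potential_cvg0 (R : realType) (y : R) :
  potential r y @[r --> 0^'+] --> potential 0 y.
Proof.
apply: cvg_within_filter; apply: cvgM; first exact: cvg_cst.
apply: cvgB; first exact: continuous_decay.
apply: (@continuous_comp _ _ _ (fun r => `|y| + r) (@decay R)).
  by apply: continuousD; [exact: cst_continuous|exact: cvg_id].
exact: continuous_decay.
Qed.

(** * Lower bound for the cost of an arbitrary trajectory *)

Lemma lagrangianE (R : realType) (t x v : R) : t != x -> `|v| <= 2 ->
  lagrangian t x v = (`|v| / 2 * decay_rate `|t - x|)%:E.
Proof.
move=> tx v2; rewrite /lagrangian (negbTE tx) v2; congr EFin.
rewrite /phi /decay_rate /decay mulNr expRN !invfM.
by rewrite [in RHS](mulrC (expR _)^-1) !mulrA.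
Qed.

Lemma lagrangian_ge0 (R : realType) (t x v : R) : (0 <= lagrangian t x v)%E.
Proof.
rewrite /lagrangian; case: ifP => _; case: ifP => _ //.
by rewrite lee_fin divr_ge0// mulr_ge0// mulr_ge0 ?sqrtr_ge0 ?expR_ge0.
Qed.

(** Where the Lagrangian is finite and [1 < v], it equals
    [v / 2 * decay_rate `|t - x|], and [v - 1 <= v / 2] because [v <= 2]. The
    remaining factor is larger without the regularization [r], as [decay_rate]
    is nonincreasing. *)
Lemma lagrangian_ge_rate (R : realType) (r t x v : R) : 0 < r ->
  ((decay_rate (`|x - t| + r) * (v - 1))%:E <= lagrangian t x v)%E.
Proof.
move=> r0; have [v1|v1] := leP v 1.
  apply: le_trans (lagrangian_ge0 t x v).
  by rewrite lee_fin mulr_ge0_le0 ?decay_rate_ge0// subr_le0.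
have [->|tx] := eqVneq t x.
  by rewrite /lagrangian eqxx ifF ?leey//; apply/negbTE; rewrite gt_eqF//; lra.
have [v2|v2] := leP `|v| 2; last first.
  by rewrite /lagrangian (negbTE tx) ifF ?leey//; apply/negbTE; rewrite -ltNge.
rewrite lagrangianE// lee_fin mulrC.
have v0 : 0 <= v by lra.
move: v2; rewrite ger0_norm// => v2.
apply: ler_pM; rewrite ?decay_rate_ge0//; [lra|lra|].
rewrite distrC; apply: decay_rate_nincr; last by rewrite lerDl ltW.
by rewrite normr_gt0 subr_eq0.
Qed.

(** Speeds above 2 cost [+oo], so that exceeding the speed 2 can be penalized by
    any factor [M]. *)
Lemma lagrangian_ge_speed (R : realType) (M t x v : R) : 0 <= M ->
  ((M * (v - 2))%:E <= lagrangian t x v)%E.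
Proof.
move=> M0; have [v2|v2] := leP v 2.
  apply: le_trans (lagrangian_ge0 t x v).
  by rewrite lee_fin mulr_ge0_le0// subr_le0.
rewrite /lagrangian; case: ifP => _.
  by rewrite ifF ?leey//; apply/negbTE; rewrite gt_eqF//; lra.
by rewrite ifF ?leey//; apply/negbTE; rewrite -ltNge (lt_le_trans v2)// ler_norm.
Qed.

Lemma V_potential (R : realType) (T t x : R) : 2 * t - T <= x ->
  V T t x = - potential 0 (x - t).
Proof.
move=> tTx; rewrite /V /potential addr0.
have d0 : decay 0 = 1 :> R by rewrite /decay sqrtr0 mulr0 expR0.
have [tx|tx] := leP t x.
  have [->|ne] := eqVneq t x.
    by rewrite subrr sgr0 mul0r oppr0 sqrtr0 mulr0 expR0 subrr.
  have xt : 0 < x - t by rewrite subr_gt0 lt_neqAle ne.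
  by rewrite gtr0_sg// mul1r gtr0_norm// d0 opprB.
rewrite tTx ltr0_sg ?subr_lt0// ltr0_norm ?subr_lt0// d0 opprB.
by rewrite mulN1r opprK.
Qed.

(** At or above the diagonal, the terminal cost is the value function at the
    final time. *)
Lemma terminal_cost_potential (R : realType) (T x : R) : T <= x ->
  terminal_cost T x = - potential 0 (x - T).
Proof.
move=> Tx; rewrite -(@V_potential _ T); last lra.
by rewrite /terminal_cost /V Tx.
Qed.

Lemma terminal_cost_geN1 (R : realType) (T x : R) : - 1 <= terminal_cost T x.
Proof.
rewrite /terminal_cost; case: ifP => _; last lra.
by rewrite lerBrDr addrC subrr expR_ge0.
Qed.

Lemma V_le1 (R : realType) (T t x : R) : V T t x <= 1.
Proof.
rewrite /V; case: ifP => _.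
  by have := decay_le1 (x - t); rewrite /decay; lra.
case: ifP => _ //; rewrite lerBlDr lerDl; exact: expR_ge0.
Qed.

Section lower_bounds.
Context (R : realType) (t0 T : R) (t0T : t0 <= T) (x : R -> R)
  (acx : absolutely_continuous t0 T x).
Let cost := (\int[lebesgue_measure]_(t in `[t0, T])
  lagrangian t (x t) (derive1 x t))%E.

(** For [r > 0], the function [t |-> potential r (x t - t)] is absolutely
    continuous, even though its limit as [r] tends to 0 may fail to be when the
    trajectory meets the diagonal; [lagrangian_ge_rate] bounds its derivative by
    the Lagrangian. The bound does not depend on [r], which then tends to 0. *)
Lemma potential_le_running_cost :
  ((potential 0 (x T - T) - potential 0 (x t0 - t0))%:E <= cost)%E.
Proof.
have main r : 0 < r ->
    ((potential r (x T - T) - potential r (x t0 - t0))%:E <= cost)%E.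
  move=> r0; have acF : absolutely_continuous t0 T (potential r \o (x \- id)).
    apply: absolutely_continuous_lipschitz (decay_rate_ge0 r) _ _.
      by move=> y z; exact: potential_lipschitz.
    exact: absolutely_continuousB acx (@absolutely_continuous_id _ _ _).
  apply: (absolutely_continuous_le_integral (F := potential r \o (x \- id)) t0T acF).
    by move=> t _; exact: lagrangian_ge0.
  have [g [_ _ dx]] := absolutely_continuous_FTC t0T acx.
  apply: filterS dx; first exact: (ae_filter_ringOfSetsType lebesgue_measure).
  move=> t dxt tT _; have {dxt}[dxt _] := dxt tT.
  have ix : is_derive t 1 x (derive1 x t).
    by apply: (DeriveDef dxt); rewrite derive1E.
  have iy : is_derive t 1 (x \- id) (derive1 x t - 1) by exact: is_deriveB.
  have [_ iF] := @is_derive1_comp R (potential r) (x \- id) t _ _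
    (is_derive_potential _ r0) iy.
  by rewrite derive1E iF; exact: lagrangian_ge_rate.
have cv : potential r (x T - T) - potential r (x t0 - t0) @[r --> 0^'+] -->
    potential 0 (x T - T) - potential 0 (x t0 - t0).
  by apply: cvgB; exact: potential_cvg0.
case: (cost) main => [c| |] main.
- rewrite lee_fin -(cvg_lim _ cv)//; apply: limr_le; first exact: cvgP cv.
  by near=> r; rewrite -lee_fin; apply: main; near: r; exact: nbhs_right_gt.
- exact: leey.
- by have := main 1 ltr01; rewrite leeNy_eq.
Unshelve. all: by end_near. Qed.

(** As [M] is arbitrary, a trajectory of finite cost moves at most at speed 2. *)
Lemma displacement_le_running_cost (M : R) : 0 <= M ->
  ((M * (x T - x t0 - 2 * (T - t0)))%:E <= cost)%E.
Proof.
move=> M0.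
pose k (y : R) := M * y.
have acF : absolutely_continuous t0 T (k \o (x \- (fun t => 2 * t))).
  apply: (absolutely_continuous_lipschitz M0).
    by move=> y z; rewrite /k -mulrBr normrM ger0_norm.
  apply: absolutely_continuousB acx _.
  apply: (@absolutely_continuous_lipschitz _ _ _ 2 (fun t => 2 * t) id) => //.
    by move=> y z; rewrite -mulrBr normrM ger0_norm.
  exact: absolutely_continuous_id.
have -> : M * (x T - x t0 - 2 * (T - t0)) =
    (k \o (x \- (fun t => 2 * t))) T - (k \o (x \- (fun t => 2 * t))) t0.
  by rewrite /k/=; ring.
apply: (absolutely_continuous_le_integral t0T acF).
  by move=> t _; exact: lagrangian_ge0.
have [g [_ _ dx]] := absolutely_continuous_FTC t0T acx.
apply: filterS dx; first exact: (ae_filter_ringOfSetsType lebesgue_measure).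
move=> t dxt tT _; have {dxt}[dxt _] := dxt tT.
have ix : is_derive t 1 x (derive1 x t).
  by apply: (DeriveDef dxt); rewrite derive1E.
have i2 : is_derive t 1 (fun t : R => 2 * t) 2.
  by apply: (is_derive_eq (is_deriveZ 2 (is_derive_id t 1))); rewrite /GRing.scale/= mulr1.
have iy : is_derive t 1 (x \- (fun t => 2 * t)) (derive1 x t - 2).
  exact: is_deriveB.
have [_ iF] : is_derive t 1 (k \o (x \- (fun t => 2 * t))) (M * (derive1 x t - 2)).
  exact: is_deriveZ.
by rewrite derive1E iF; exact: lagrangian_ge_speed.
Qed.

End lower_bounds.

(** A trajectory ending below the diagonal pays a terminal cost 1, which bounds
    the value function. A trajectory starting below [2 * t0 - T] and ending at or
    above [T] is too fast: its running cost is at least 2, while the terminal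
    cost is at least -1. In the other cases both ends are described by
    [potential 0]. *)
Lemma V_le_bolza_cost (R : realType) (T t0 : R) (x : R -> R) : t0 <= T ->
  absolutely_continuous t0 T x ->
  ((V T t0 (x t0))%:E <= bolza_cost (@lagrangian R) (terminal_cost T) t0 T x)%E.
Proof.
move=> t0T acx; rewrite /bolza_cost.
set I := (\int[_]_(_ in _) _)%E.
have I0 : (0 <= I)%E by apply: integral_ge0 => t _; exact: lagrangian_ge0.
have [xT|Tx] := ltP (x T) T.
  rewrite /terminal_cost [T <= _]leNgt xT/= (@le_trans _ _ 1%E)//.
    by rewrite lee_fin V_le1.
  by rewrite leeDl.
have [far|near] := ltP (x t0) (2 * t0 - T).
  (* D is the least possible excess of the displacement over 2 * (T - t0), so the
     penalty factor 2 / D makes the running cost at least 2. *)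
  pose D := 2 * t0 - T - x t0.
  have D0 : 0 < D by rewrite subr_gt0.
  have M0 : 0 <= 2 / D by rewrite divr_ge0// ltW.
  have := displacement_le_running_cost t0T acx M0.
  rewrite -/I => I2; have {I2} I2 : (2%:E <= I)%E.
    apply: le_trans I2; rewrite lee_fin -[leLHS](divfK (lt0r_neq0 D0)).
    by rewrite ler_wpM2l// /D; lra.
  apply: (@le_trans _ _ ((- 1)%:E + 2%:E)%E).
    by rewrite -EFinD lee_fin (le_trans (V_le1 _ _ _))//; lra.
  by rewrite leeD// lee_fin terminal_cost_geN1.
rewrite V_potential// terminal_cost_potential//.
apply: (le_trans _ (leeD2l _ (potential_le_running_cost t0T acx))).
by rewrite -EFinD lee_fin; lra.
Qed.

(** * Optimal trajectories *)

Lemma continuous_decay_rate_norm (R : realType) (r c : R) : 0 < r ->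
  continuous (fun t : R => decay_rate (`|c + t| + r)).
Proof.
move=> r0 t.
apply: (@continuous_comp _ _ _ (fun t => `|c + t| + r) (@decay_rate R)); last first.
  by apply: continuous_decay_rate; rewrite ltr_wpDl.
apply: continuousD; last exact: cst_continuous.
apply: (@continuous_comp _ _ _ (fun t => c + t) Num.norm); last exact: norm_continuous.
by apply: continuousD; [exact: cst_continuous|exact: cvg_id].
Qed.

Lemma integral_decay_rate (R : realType) (r a b c : R) : 0 < r -> a < b ->
  (\int[lebesgue_measure]_(t in `[a, b]) (decay_rate (`|c + t| + r))%:E =
   (potential r (c + b) - potential r (c + a))%:E)%E.
Proof.
move=> r0 ab.
have iF (t : R) : is_derive t 1 (fun t => potential r (c + t)) (decay_rate (`|c + t| + r)).
  have ic : is_derive t 1 (fun t : R => c + t) 1.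
    have h := is_deriveD (is_derive_cst c t 1) (is_derive_id t 1).
    by apply: (is_derive_eq h); rewrite add0r.
  have h := @is_derive1_comp R (potential r) (fun t => c + t) t _ _
    (is_derive_potential (c + t) r0) ic.
  by apply: (is_derive_eq h); rewrite mulr1.
have cF (t : R) : {for t, continuous (fun t => potential r (c + t))}.
  apply: differentiable_continuous; apply/derivable1_diffP.
  by have [] := iF t.
rewrite (@continuous_FTC2 _ _ (fun t => potential r (c + t)))//.
- by apply: continuous_subspaceT => t; exact: continuous_decay_rate_norm.
- split.
  + by move=> t _; have [] := iF t.
  + by apply: cvg_at_right_filter; exact: cF.
  + by apply: cvg_at_left_filter; exact: cF.
- by move=> t _; rewrite derive1E; have [] := iF t.
Qed.

(** The convergence also holds at the points of the diagonal, where both the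
    Lagrangian and the limit are [+oo]; the square on the regularization parameter
    makes the square root in [decay_rate] explicit there. *)
Lemma lagrangian_cvg (R : realType) (t x : R) :
  (decay_rate (`|x - t| + n.+1%:R^-1 ^+ 2))%:E @[n --> \oo] --> lagrangian t x 2.
Proof.
have cv0 : (n.+1%:R^-1 : R) ^+ 2 @[n --> \oo] --> (0 : R).
  by rewrite -[X in _ --> X](mulr0 (0 : R)); apply: cvgM; exact: cvg_harmonic.
have [tx|tx] := eqVneq t x.
  rewrite /lagrangian tx eqxx subrr normr0 ifF; last by apply/negbTE; rewrite pnatr_eq0.
  apply/cvgeryP; apply/cvgryPge => A.
  near=> n; rewrite add0r /decay_rate sqrtr_sqr ger0_norm// invrK.
  apply: (@le_trans _ _ (decay 1 * n.+1%:R)).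
    rewrite mulrC -ler_pdivrMr ?expR_gt0//.
    apply: (@le_trans _ _ n%:R); last by rewrite ler_nat.
    near: n; exact: nbhs_infty_ger.
  rewrite ler_pM2r//; apply: decay_nincr.
  by rewrite expr_le1// invf_le1// ler1n.
rewrite lagrangianE//; last by rewrite ger0_norm.
rewrite (ger0_norm (ler0n R 2)) divff// mul1r.
apply: cvg_EFin; first exact: nearW.
apply: (@cvg_comp _ _ _ (fun n => `|x - t| + n.+1%:R^-1 ^+ 2) (@decay_rate R)); last first.
  by apply: continuous_decay_rate; rewrite normr_gt0 subr_eq0.
have h : `|x - t| + n.+1%:R^-1 ^+ 2 @[n --> \oo] --> `|x - t| + 0.
  by apply: cvgD => //; exact: cvg_cst.
by rewrite addr0 in h; rewrite (distrC t).
Unshelve. all: by end_near. Qed.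

(** The integrand may be infinite at the time when the trajectory crosses the
    diagonal. It is the increasing limit of the continuous regularized slopes,
    whose integrals are increments of the regularized potential, so monotone
    convergence gives the value without splitting the interval there. *)
Lemma integral_lagrangian_double_speed (R : realType) (a b c : R) : a <= b ->
  (\int[lebesgue_measure]_(t in `[a, b]) lagrangian t (c + t + t) 2 =
   (potential 0 (c + b) - potential 0 (c + a))%:E)%E.
Proof.
rewrite le_eqVlt => /predU1P[->|ab].
  by rewrite set_itv1 integral_set1 subrr.
pose r n : R := n.+1%:R^-1 ^+ 2.
have r0 n : 0 < r n by rewrite exprn_gt0.
have cE (t : R) : c + t + t - t = c + t by rewrite addrK.
transitivity (\int[lebesgue_measure]_(t in `[a, b])
    (limn (fun n => (decay_rate (`|c + t| + r n))%:E)))%E.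
  apply: eq_integral => t _; apply/esym/cvg_lim => //.
  by rewrite -{1}(cE t); exact: lagrangian_cvg.
rewrite monotone_convergence//.
- apply/cvg_lim => //.
  under eq_fun do rewrite integral_decay_rate//.
  apply: cvg_EFin; first exact: nearW.
  have cvr : r n @[n --> \oo] --> 0^'+.
    have cv0 : r n @[n --> \oo] --> (0 : R).
      by rewrite -[X in _ --> X](mulr0 (0 : R)); apply: cvgM; exact: cvg_harmonic.
    move=> A hA; have h : \forall n \near \oo, 0 < r n -> A (r n) := cv0 _ hA.
    by apply: filterS h => n; apply; exact: r0.
  pose q s := potential s (c + b) - potential s (c + a).
  have cvq : q s @[s --> 0^'+] --> q 0 by apply: cvgB; exact: potential_cvg0.
  have cvqr : (q \o r) n @[n --> \oo] --> q 0 by exact: cvg_comp cvr cvq.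
  exact: cvqr.
- move=> n; apply/measurable_EFinP/measurable_funTS.
  by apply: continuous_measurable_fun => t; exact: continuous_decay_rate_norm.
- by move=> n t _; rewrite lee_fin decay_rate_ge0.
- move=> t _ m n mn; rewrite lee_fin; apply: decay_rate_nincr.
    by rewrite ltr_wpDl.
  rewrite lerD2l /r ler_pXn2r ?nnegrE//.
  by rewrite lef_pV2 ?posrE// ler_nat.
Qed.

(** Too far below the diagonal to reach it in time, it is optimal not to
    move. *)
Lemma bolza_cost_cst (R : realType) (T t0 x0 : R) : x0 < 2 * t0 - T -> t0 <= T ->
  bolza_cost (@lagrangian R) (terminal_cost T) t0 T (cst x0) = (V T t0 x0)%:E.
Proof.
move=> far t0T; rewrite /bolza_cost/= /terminal_cost ifF; last first.
  by apply/negbTE; rewrite -ltNge; lra.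
have xt : x0 < t0 by lra.
rewrite /V [t0 <= _]leNgt xt/= [_ - T <= _]leNgt far/=.
rewrite integral0_eq ?adde0// => t _.
by rewrite derive1_cst /lagrangian eqxx normr0 mul0r ler0n; case: ifP.
Qed.

(** At speed 2, the inequality of [lagrangian_ge_rate] becomes an equality in the
    limit where [r] vanishes. *)
Lemma bolza_cost_double_speed (R : realType) (T t0 x0 : R) :
  2 * t0 - T <= x0 -> t0 <= T ->
  bolza_cost (@lagrangian R) (terminal_cost T) t0 T (fun t => x0 + 2 * (t - t0)) =
  (V T t0 x0)%:E.
Proof.
move=> near t0T; rewrite /bolza_cost.
have dp (t : R) : derive1 (fun t => x0 + 2 * (t - t0)) t = 2.
  have h := is_deriveD (is_derive_cst x0 t 1) (is_deriveZ 2
    (is_deriveB (is_derive_id t 1) (is_derive_cst t0 t 1))).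
  have [_ E] := h.
  rewrite derive1E; apply: etrans E _.
  by rewrite add0r subr0 /GRing.scale/= mulr1.
under eq_integral => t _.
  rewrite dp (_ : x0 + 2 * (t - t0) = (x0 - 2 * t0) + t + t); last ring.
  over.
rewrite integral_lagrangian_double_speed// terminal_cost_potential; last lra.
rewrite V_potential// -EFinD; congr EFin.
have -> : x0 - 2 * t0 + T = x0 + 2 * (T - t0) - T by ring.
have -> : x0 - 2 * t0 + t0 = x0 - t0 by ring.
ring.
Qed.

Theorem mainTheorem5 (R : realType) (T : R) (hT : 0 < T)
    (t0 x0 : R) (ht0 : 0 <= t0 <= T) :
  (V T t0 x0)%:E =
  value_function (@lagrangian R) (terminal_cost T) T t0 x0.
Proof.
have t0T : t0 <= T by have /andP[] := ht0.
apply/eqP; rewrite eq_le; apply/andP; split.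
  by apply: le_ereal_inf_tmp => _ [x [acx <-] <-]; exact: V_le_bolza_cost.
apply: ereal_inf_lbound; have [far|near] := ltP x0 (2 * t0 - T).
  exists (cst x0); last exact: bolza_cost_cst.
  split => // e e0; exists 1 => // n a b _ _ _.
  by rewrite big1// => i _; rewrite subrr normr0.
exists (fun t => x0 + 2 * (t - t0)); last exact: bolza_cost_double_speed.
split; last by rewrite subrr mulr0 addr0.
apply: (@absolutely_continuous_lipschitz _ _ _ 2 (fun t => x0 + 2 * (t - t0)) id) => //.
  move=> y z; rewrite (_ : _ - _ = 2 * (z - y)); last ring.
  by rewrite normrM ger0_norm.
exact: absolutely_continuous_id.
Qed.
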